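(* Let $C$ be a nonempty subset of a $W$-hyperbolic space $X$ and let $T:C\to C$ be a $\lambda$-firmly nonexpansive mapping with $\lambda\in(0,1)$. Then for all $x\in C$ and all integers $k\ge1$, the following limits exist and $$\lim_{n\to\infty}d(T^{n+1}x,T^nx)=\frac1k\lim_{n\to\infty}d(T^{n+k}x,T^nx)=\lim_{n\to\infty}\frac{d(T^nx,x)}{n}=r_C(T),$$ where $r_C(T):=\inf\{d(x,Tx)\mid x\in C\}$ is the minimal displacement of $T$.
   Context: A $W$-hyperbolic space $(X,d,W)$ is a metric space $(X,d)$ together with a map $W:X\times X\times[0,1]\to X$ (a convexity mapping) such that for all $x,y,z,w\in X$ and $\lambda,\tilde\lambda\in[0,1]$: (W1) $d(z,W(x,y,\lambda))\le(1-\lambda)d(z,x)+\lambda d(z,y)$; (W2) $d(W(x,y,\lambda),W(x,y,\tilde\lambda))=|\lambda-\tilde\lambda|\,d(x,y)$; (W3) $W(x,y,\lambda)=W(y,x,1-\lambda)$; (W4) $d(W(x,z,\lambda),W(y,w,\lambda))\le(1-\lambda)d(x,y)+\lambda d(z,w)$. One writes $(1-\lambda)x\oplus\lambda y:=W(x,y,\lambda)$. For $C\subseteq X$ and $\lambda\in(0,1)$, a map $T:C\to X$ is $\lambda$-firmly nonexpansive if $d(Tx,Ty)\le d((1-\lambda)x\oplus\lambda Tx,(1-\lambda)y\oplus\lambda Ty)$ for all $x,y\in C$. *)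

(* Defs.v *)
From HB Require Import structures.
From mathcomp Require Import all_boot all_order all_algebra.
From mathcomp Require Import all_classical all_reals all_analysis.

Set Implicit Arguments.
Unset Strict Implicit.
Unset Printing Implicit Defensive.

Import Order.TTheory GRing.Theory Num.Theory.
Import numFieldNormedType.Exports.

Local Open Scope classical_set_scope.
Local Open Scope ring_scope.

(* The convexity mapping is a total function of a real parameter, but only its
   values for parameters in [0, 1] are constrained or used. *)
Record W_hyperbolic (R : realType) (X : metricType R)
    (W : X -> X -> R -> X) : Prop := {
  W_hyperbolic1 : forall (x y z : X) (t : R), 0 <= t <= 1 ->
    mdist z (W x y t) <= (1 - t) * mdist z x + t * mdist z y ;
  W_hyperbolic2 : forall (x y : X) (t s : R), 0 <= t <= 1 -> 0 <= s <= 1 ->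
    mdist (W x y t) (W x y s) = `|t - s| * mdist x y ;
  W_hyperbolic3 : forall (x y : X) (t : R), 0 <= t <= 1 ->
    W x y t = W y x (1 - t) ;
  W_hyperbolic4 : forall (x y z w : X) (t : R), 0 <= t <= 1 ->
    mdist (W x z t) (W y w t) <= (1 - t) * mdist x y + t * mdist z w
}.

(* A map defined on C is represented by a total map on X, of which only the
   values on C matter. *)
Definition firmly_nonexpansive (R : realType) (X : metricType R)
    (W : X -> X -> R -> X) (lambda : R) (C : set X) (T : X -> X) : Prop :=
  forall x y : X, C x -> C y ->
    mdist (T x) (T y) <= mdist (W x (T x) lambda) (W y (T y) lambda).

Definition minimal_displacement (R : realType) (X : metricType R)
    (C : set X) (T : X -> X) : R :=
  inf [set mdist x (T x) | x in C].

(* Main.v *)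
Require Import Defs.
From HB Require Import structures.
From mathcomp Require Import all_boot all_order all_algebra.
From mathcomp Require Import all_classical all_reals all_analysis.
From mathcomp Require Import ring lra.

Set Implicit Arguments.
Unset Strict Implicit.
Unset Printing Implicit Defensive.

Import Order.TTheory GRing.Theory Num.Theory.
Import numFieldNormedType.Exports.

Local Open Scope classical_set_scope.
Local Open Scope ring_scope.

(** Write [x_n] for the orbit of [x] and [L_k] for the limit of the
    nonincreasing sequence [d(x_{n+k}, x_n)]. Firm nonexpansiveness, expanded
    by repeated use of (W1) and passed to the limit, makes [k |-> L_k] convex;
    as [L_0 = 0], this gives [k L_1 <= L_k <= d(x_k, x)]. On the other hand
    [r <= L_1] for [r] the minimal displacement, while
    [d(x_n, x) <= n d(y, Ty) + 2 d(x, y)] for every [y] in [C]. Dividing by [n]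
    forces the convergence of [d(x_n, x) / n] to [r = L_1], and then
    [k r <= L_k <= k L_1] gives [L_k = k r]. *)

(** Convexity makes the increments [u k.+1 - u k] nondecreasing, so each is at least the first one,
    which is [u 1] because [u 0 = 0]; summing them gives the bound. *)
Lemma convex_seq_ge_linear (R : realFieldType) (u : nat -> R) :
  u 0%N = 0 -> (forall k, 2 * u k.+1 <= u k + u k.+2) ->
  forall k, k%:R * u 1%N <= u k.
Proof.
move=> u0 cvx.
have incr k : u 1%N <= u k.+1 - u k.
  by elim: k => [|k IH]; [rewrite u0 subr0 | have := cvx k; lra].
elim=> [|k IH]; first by rewrite mul0r u0.
by rewrite -natr1; have := incr k; lra.
Qed.

Section NonexpansiveOrbit.
Context {R : realType} {X : metricType R} (C : set X) (T : X -> X).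
Hypothesis CT : set_fun C C T.
Hypothesis Tne : forall x y, C x -> C y -> mdist (T x) (T y) <= mdist x y.

Lemma iter_mem x n : C x -> C (iter n T x).
Proof. by move=> Cx; elim: n => //= n; exact: CT. Qed.

Lemma iter_nonexpansive x y n : C x -> C y ->
  mdist (iter n T x) (iter n T y) <= mdist x y.
Proof.
move=> Cx Cy; elim: n => //= n; apply: le_trans.
by apply: Tne; exact: iter_mem.
Qed.

Lemma dist_iter_le y n : C y -> mdist (iter n T y) y <= n%:R * mdist y (T y).
Proof.
move=> Cy; elim: n => [|n IH]; first by rewrite mdistxx mul0r.
have := metric_triangle (iter n.+1 T y) (T y) y.
rewrite -natr1 mulrDl mul1r iterS (metric_sym (T y) y).
by have := Tne (iter_mem n Cy) Cy; lra.
Qed.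

(** The orbits of [x] and [y] stay within [mdist x y] of each other, so changing the base point
    costs a constant independent of [n], which vanishes after division by [n]. *)
Lemma dist_iter_le_base x y n : C x -> C y ->
  mdist (iter n T x) x <= n%:R * mdist y (T y) + 2 * mdist x y.
Proof.
move=> Cx Cy; have := iter_nonexpansive n Cx Cy; have := dist_iter_le n Cy.
have := metric_triangle (iter n T x) (iter n T y) x.
have := metric_triangle (iter n T y) y x; rewrite (metric_sym y x); lra.
Qed.

Lemma dist_shift_nonincreasing x k : C x ->
  nonincreasing_seq (fun n => mdist (iter (n + k) T x) (iter n T x)).
Proof.
move=> Cx; apply/nonincreasing_seqP => n; rewrite addSn !iterS.
by apply: Tne; exact: iter_mem.
Qed.

Lemma dist_shift_cvgn x k : C x ->
  cvgn (fun n => mdist (iter (n + k) T x) (iter n T x)).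
Proof.
move=> Cx; apply: nonincreasing_is_cvgn; first exact: dist_shift_nonincreasing.
by exists 0 => _ [n _ <-]; exact: mdist_ge0.
Qed.

Lemma minimal_displacement_le y : C y ->
  minimal_displacement C T <= mdist y (T y).
Proof.
move=> Cy; apply: ge_inf; last by exists y.
by exists 0 => _ [z _ <-]; exact: mdist_ge0.
Qed.

Definition shift_limit (x : X) (k : nat) : R :=
  limn (fun n => mdist (iter (n + k) T x) (iter n T x)).

Lemma shift_limit0 x : shift_limit x 0 = 0.
Proof.
rewrite /shift_limit; under eq_fun do rewrite addn0 mdistxx.
exact: lim_cst.
Qed.

Lemma shift_limit_le x k : C x -> shift_limit x k <= mdist (iter k T x) x.
Proof.
move=> Cx; exact: nonincreasing_cvgn_ge (dist_shift_nonincreasing k Cx)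
  (dist_shift_cvgn (k := k) Cx) 0%N.
Qed.

Lemma minimal_displacement_le_shift_limit x : C x ->
  minimal_displacement C T <= shift_limit x 1.
Proof.
move=> Cx; apply: limr_ge; first exact: dist_shift_cvgn.
apply: nearW => n; rewrite addn1 iterS metric_sym.
by apply: minimal_displacement_le; exact: iter_mem.
Qed.

Lemma dist_shift_le_step x n k : C x ->
  mdist (iter (n + k) T x) (iter n T x) <=
  k%:R * mdist (iter (n + 1) T x) (iter n T x).
Proof.
move=> Cx; have := dist_iter_le k (iter_mem n Cx).
by rewrite -iterD addnC addn1 iterS (metric_sym (T _)).
Qed.

Lemma shift_limit_le_linear x k : C x ->
  shift_limit x k <= k%:R * shift_limit x 1.
Proof.
move=> Cx; have c j := dist_shift_cvgn (k := j) Cx.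
apply: (ler_cvg_to (c k) (cvgMl_tmp (c 1%N))).
by apply: nearW => n; exact: dist_shift_le_step.
Qed.

Lemma iter_rate_cvg x : C x ->
  (forall n, n%:R * minimal_displacement C T <= mdist (iter n T x) x) ->
  mdist (iter n T x) x / n%:R @[n --> \oo] --> minimal_displacement C T.
Proof.
set r := minimal_displacement C T => Cx lower.
apply/cvgrPdist_le => e e0.
(* Half of [e] pays for the near-minimizer [y]; the other half absorbs [2 * mdist x y / n] once [n]
   is large. *)
have [_ [y Cy <-] yr] : exists2 a, [set mdist z (T z) | z in C] a & a < r + e / 2.
  apply: inf_adherent; first by rewrite divr_gt0.
  split; first by exists (mdist x (T x)); exists x.
  by exists 0 => _ [z _ <-]; exact: mdist_ge0.
near=> n.
have n0 : 0 < n%:R :> R by rewrite ltr0n; near: n; exact: nbhs_infty_gt.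
have nbig : 4 * mdist x y / e <= n%:R by near: n; exact: nbhs_infty_ger.
rewrite distrC ger0_norm; last by rewrite subr_ge0 ler_pdivlMr// mulrC.
rewrite lerBlDr ler_pdivrMr//; move: nbig; rewrite ler_pdivrMr// => nbig.
have := dist_iter_le_base n Cx Cy.
by have := ler_wpM2l (ltW n0) (ltW yr); lra.
Unshelve. all: by end_near. Qed.

End NonexpansiveOrbit.

Section FirmlyNonexpansive.
Context {R : realType} {X : metricType R} (W : X -> X -> R -> X).
Context (C : set X) (T : X -> X) (lambda : R).
Hypothesis hW : W_hyperbolic W.
Hypothesis lambda01 : 0 < lambda < 1.
Hypothesis firm : firmly_nonexpansive W lambda C T.

Let lambda_itv : 0 <= lambda <= 1.
Proof. by case/andP: lambda01 => /ltW -> /ltW ->. Qed.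

(** (W4) bounds the right side of firmness by a convex combination of [mdist x y] and
    [mdist (T x) (T y)]; the latter is absorbed on the left since [lambda < 1]. *)
Lemma firmly_nonexpansive_nonexpansive x y : C x -> C y ->
  mdist (T x) (T y) <= mdist x y.
Proof.
move=> Cx Cy; have := firm Cx Cy.
have := W_hyperbolic4 hW x y (T x) (T y) lambda_itv.
by case/andP: lambda01; nra.
Qed.

(** (W1) is used first on the combination of [y] and [T y], then on that of [x] and [T x], seen from
    [y] and from [T y]. *)
Lemma firmly_nonexpansive_expand x y : C x -> C y ->
  mdist (T x) (T y) <=
  (1 - lambda) * ((1 - lambda) * mdist x y + lambda * mdist (T x) y) +
  lambda * ((1 - lambda) * mdist x (T y) + lambda * mdist (T x) (T y)).
Proof.
move=> Cx Cy; apply: le_trans (firm Cx Cy) _.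
apply: le_trans (W_hyperbolic1 hW _ _ _ lambda_itv) _.
have bound z : mdist (W x (T x) lambda) z <=
    (1 - lambda) * mdist x z + lambda * mdist (T x) z.
  rewrite !(metric_sym _ z).
  exact: (W_hyperbolic1 hW _ _ _ lambda_itv).
case/andP: lambda01 => l0 l1.
by rewrite lerD// ler_pM2l ?subr_gt0.
Qed.

Hypothesis CT : set_fun C C T.

Lemma shift_limit_convex x k : C x ->
  2 * shift_limit T x k.+1 <= shift_limit T x k + shift_limit T x k.+2.
Proof.
move=> Cx; have Tne := firmly_nonexpansive_nonexpansive.
have c j := dist_shift_cvgn CT Tne (k := j) Cx.
have noninc j := dist_shift_nonincreasing CT Tne j Cx.
(* Since [(1 - lambda ^+ 2) - (1 - lambda) ^+ 2 = 2 * lambda * (1 - lambda)], dividing by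
   [lambda * (1 - lambda)] gives the claim. *)
suff : (1 - lambda ^+ 2) * shift_limit T x k.+1 <=
    (1 - lambda) ^+ 2 * shift_limit T x k.+1 +
    lambda * (1 - lambda) * (shift_limit T x k.+2 + shift_limit T x k).
  case/andP: lambda01 => l0 l1 le_lim.
  have l2 : 0 < lambda * (1 - lambda) by rewrite mulr_gt0// subr_gt0.
  by rewrite -(ler_pM2l l2); lra.
apply: (ler_cvg_to (cvg_cst _) (cvgD (cvgMl_tmp (c k.+1))
  (cvgMl_tmp (cvgD (c k.+2) (c k))))).
apply: nearW => n /=.
(* The expansion at [x_{n+k+1}] and [x_n] mixes the indices [n] and [n.+1]. Monotonicity replaces
   the left term by its limit and moves the shift-[k] term back to index [n]. *)
have L_le := nonincreasing_cvgn_ge (noninc k.+1) (c k.+1) n.+1.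
have step_le : mdist (iter (n.+1 + k) T x) (iter n.+1 T x) <=
    mdist (iter (n + k) T x) (iter n T x) by exact: noninc.
have := firmly_nonexpansive_expand (iter_mem CT (n + k.+1) Cx)
  (iter_mem CT n Cx).
have -> : iter (n + k.+1) T x = iter (n.+1 + k) T x by rewrite addSnnS.
rewrite !fctE -!iterS !addnS !addSn in L_le *.
case/andP: lambda01 => l0 l1.
have w1 : 0 <= 1 - lambda ^+ 2 by rewrite subr_ge0 expr_le1// ltW.
have w2 : 0 <= lambda * (1 - lambda) by rewrite mulr_ge0// ?subr_ge0 ltW.
have := ler_wpM2l w1 L_le; have := ler_wpM2l w2 step_le.
rewrite -/(shift_limit T x k.+1) !addSn; lra.
Qed.

End FirmlyNonexpansive.

Theorem theorem5p1 (R : realType) (X : metricType R) (W : X -> X -> R -> X)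
    (C : set X) (T : X -> X) (lambda : R)
    (hW : W_hyperbolic W) (hC : C !=set0) (hT : set_fun C C T)
    (hlambda : 0 < lambda < 1) (hfirm : firmly_nonexpansive W lambda C T)
    (x : X) (hx : C x) (k : nat) (hk : (1 <= k)%N) :
  let step : R^nat := fun n => mdist (iter n.+1 T x) (iter n T x) in
  let kstep : R^nat := fun n => mdist (iter (n + k) T x) (iter n T x) in
  let rate : R^nat := fun n => mdist (iter n T x) x / n%:R in
  [/\ cvgn step, cvgn kstep & cvgn rate] /\
  [/\ limn step = k%:R^-1 * limn kstep,
      k%:R^-1 * limn kstep = limn rate
    & limn rate = minimal_displacement C T].
Proof.
move=> step kstep rate.
have Tne := firmly_nonexpansive_nonexpansive hW hlambda hfirm.
have stepE : step = fun n => mdist (iter (n + 1) T x) (iter n T x).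
  by apply/funext => n; rewrite addn1.
have lin j : j%:R * shift_limit T x 1 <= shift_limit T x j.
  apply: convex_seq_ge_linear; first exact: shift_limit0.
  by move=> i; exact: (shift_limit_convex hW hlambda hfirm hT).
have r_le := minimal_displacement_le_shift_limit hT Tne hx.
have L_le j : j%:R * shift_limit T x 1 <= mdist (iter j T x) x.
  exact: le_trans (lin j) (shift_limit_le hT Tne j hx).
have rate_cvg : rate @ \oo --> minimal_displacement C T.
  apply: iter_rate_cvg => // n.
  by apply: le_trans (L_le n); rewrite ler_wpM2l.
have L1 : shift_limit T x 1 = minimal_displacement C T.
  apply/eqP; rewrite eq_le r_le andbT.
  (* The comparison starts at [n = 1]: at [n = 0] the quotient is [0] by the convention for division
     by zero. *)
  apply: (ler_cvg_to (cvg_cst _) rate_cvg); exists 1%N => // n /= n0.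
  by rewrite ler_pdivlMr ?ltr0n// mulrC.
(* Convexity gives the lower bound, the triangle inequality along the orbit the upper one. *)
have limk : limn kstep = k%:R * minimal_displacement C T.
  apply/eqP; rewrite -L1 eq_le lin andbT.
  exact: (shift_limit_le_linear hT Tne k hx).
have limr : limn rate = minimal_displacement C T by exact: cvg_lim.
split; split.
- by rewrite stepE; exact: (dist_shift_cvgn hT Tne hx).
- exact: (dist_shift_cvgn hT Tne hx).
- exact: cvgP rate_cvg.
- rewrite limk mulKf ?pnatr_eq0 -?lt0n//.
  by rewrite stepE.
- by rewrite limk limr mulKf ?pnatr_eq0 -?lt0n.
- by [].
Qed.
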